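(* Let $n,k$ be integers with $1\le k<\lfloor n/2\rfloor$, $n$ even, and $(2k+1)\mid n$, and let $G=C_n^k$ be the corresponding power of cycle graph. Then the equitable total chromatic number of $G$ equals its total chromatic number, i.e. $\chi''_{=}(G)=\chi''(G)$. Further, $\chi''_{\Sigma}(G)\le 2k+3=\Delta(G)+3$.
   Context: All graphs are finite, simple and undirected. A total coloring of a graph $G$ is a coloring of the vertices and edges of $G$ such that no two adjacent vertices, no two adjacent edges, and no edge and a vertex incident with it receive the same color. The total chromatic number $\chi''(G)$ is the minimum number of colors in a total coloring of $G$, and $\Delta(G)$ is the maximum degree. An equitable total coloring is a total coloring in which the sizes of any two color classes (each class consisting of all vertices and edges of a given color) differ by at most one; the equitable total chromatic number $\chi''_{=}(G)$ is the minimum number of colors in an equitable total coloring. A total $k$-coloring $c$ of $G$ with colors $1,\ldots,k$ is neighborhood sum distinguishing if $\sum_c(u)\ne\sum_c(v)$ for every edge $uv$, where $\sum_c(u)$ is the sum of the color of the vertex $u$ and the colors of all edges incident with $u$; $\chi''_{\Sigma}(G)$ is the minimum number of colors $k$ for which such a coloring exists. For integers $1\le k<\lfloor n/2\rfloor$, the power of cycle $C_n^k$ is the graph with vertex set $\mathbb{Z}_n$ in which distinct $x,y$ are adjacent if and only if $x-y\in\{\pm1,\pm2,\ldots,\pm k\}$ modulo $n$. *)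

(* Defs.v *)
From mathcomp Require Import all_boot.

Set Implicit Arguments.
Unset Strict Implicit.
Unset Printing Implicit Defensive.

Record sgraph := SGraph {
  vertex :> finType;
  adj : rel vertex;
  adj_sym : symmetric adj;
  adj_irrefl : irreflexive adj }.

Definition edges (G : sgraph) : {set {set G}} :=
  [set E | [exists x : G, exists y : G, adj x y && (E == [set x; y])]].

Definition edge (G : sgraph) : finType := {E : {set G} | E \in edges G}.

Definition element (G : sgraph) : finType := (vertex G + edge G)%type.

Definition max_degree (G : sgraph) : nat := \max_(x : G) #|[set y | adj x y]|.

Definition conflict (G : sgraph) (s t : element G) : bool :=
  match s, t with
  | inl u, inl v => adj u v
  | inr e, inr f => (e != f) && (val e :&: val f != set0)
  | inl u, inr e | inr e, inl u => u \in val e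
  end.

(* The color i : 'I_q stands for the color i + 1 of {1, ..., q}. *)
Definition coloring (G : sgraph) (q : nat) := {ffun element G -> 'I_q}.

Definition total_coloring (G : sgraph) (q : nat) (c : coloring G q) : bool :=
  [forall s, forall t, conflict s t ==> (c s != c t)].

Definition color_class (G : sgraph) (q : nat) (c : coloring G q) (i : 'I_q) :
  {set element G} := [set t | c t == i].

Definition equitable (G : sgraph) (q : nat) (c : coloring G q) : bool :=
  [forall i, forall j, #|color_class c i| <= #|color_class c j| + 1].

Definition color_sum (G : sgraph) (q : nat) (c : coloring G q) (u : G) : nat :=
  (c (inl u)).+1 + \sum_(e : edge G | u \in val e) (c (inr e)).+1.

Definition sum_distinguishing (G : sgraph) (q : nat) (c : coloring G q) : bool :=
  [forall u : G, forall v : G, adj u v ==> (color_sum c u != color_sum c v)].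

Definition total_colorable (G : sgraph) (q : nat) : bool :=
  [exists c : coloring G q, total_coloring c].

Definition equitably_total_colorable (G : sgraph) (q : nat) : bool :=
  [exists c : coloring G q, total_coloring c && equitable c].

Definition sum_total_colorable (G : sgraph) (q : nat) : bool :=
  [exists c : coloring G q, total_coloring c && sum_distinguishing c].

Lemma conflict_neq (G : sgraph) (s t : element G) : conflict s t -> s != t.
Proof.
case: s t => [u|e] [v|f] //=; last by case/andP.
by move=> uv; apply: contraTneq uv => -[->]; rewrite adj_irrefl.
Qed.

Lemma equitably_total_colorable_ex (G : sgraph) :
  exists q, equitably_total_colorable G q.
Proof.
exists #|element G|; apply/existsP; exists [ffun t => enum_rank t].
apply/andP; split.
  apply/forallP=> s; apply/forallP=> t; apply/implyP=> /conflict_neq.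
  by rewrite !ffunE (inj_eq enum_rank_inj).
have E i : color_class [ffun t : element G => enum_rank t] i = [set enum_val i].
  by apply/setP=> t; rewrite !inE ffunE (can2_eq enum_rankK enum_valK).
by apply/forallP=> i; apply/forallP=> j; rewrite !E !cards1.
Qed.

Lemma total_colorable_ex (G : sgraph) : exists q, total_colorable G q.
Proof.
have [q /existsP[c /andP[ct _]]] := equitably_total_colorable_ex G.
by exists q; apply/existsP; exists c.
Qed.

Lemma sum_total_colorable_ex (G : sgraph) : exists q, sum_total_colorable G q.
Proof.
pose m := #|edge G|; pose M := (m * m).+1.
have mM : m < M by rewrite ltnS; case: (m) => // p; rewrite leq_pmulr.
pose f (t : element G) : nat := match t with
  | inl u => M * (enum_rank u).+1
  | inr e => enum_rank e end.
have fb t : f t < (M * #|G| + m).+1.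
  case: t => [u|e] /=; rewrite ltnS.
    by apply: leq_trans (leq_addr _ _); rewrite leq_mul2l ltn_ord orbT.
  by apply: leq_trans (leq_addl _ _); apply: ltnW.
have eM (e : edge G) (u : G) : enum_rank e < M * (enum_rank u).+1.
  by rewrite (leq_trans (ltn_ord _)) // (leq_trans (ltnW mM)) // leq_pmulr.
exists (M * #|G| + m).+1; apply/existsP; exists [ffun t => Ordinal (fb t)].
apply/andP; split.
  apply/forallP=> s; apply/forallP=> t; apply/implyP=> /conflict_neq st.
  rewrite !ffunE -val_eqE /=; case: s t st => [u|e] [v|g] /=.
  - by rewrite eqn_pmul2l // eqSS val_eqE (inj_eq enum_rank_inj).
  - by move=> _; rewrite eq_sym ltn_eqF.
  - by move=> _; rewrite ltn_eqF.
  - by rewrite val_eqE (inj_eq enum_rank_inj).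
apply/forallP=> u; apply/forallP=> v; apply/implyP=> uv.
have E w : (color_sum [ffun t => Ordinal (fb t)] w).-1 %/ M = (enum_rank w).+1.
  rewrite /color_sum !ffunE /= mulnC divnMDl // divn_small ?addn0 // ltnS.
  rewrite (@leq_trans (\sum_(e : edge G) m)) //; last by rewrite sum_nat_const.
  rewrite big_mkcond leq_sum // => e _; case: ifP => // _.
  by rewrite ffunE /= ltn_ord.
apply: contraTneq uv => /(congr1 (fun s => s.-1 %/ M)).
rewrite !E => -[] /val_inj/enum_rank_inj->.
by rewrite adj_irrefl.
Qed.

Definition total_chromatic (G : sgraph) : nat :=
  ex_minn (total_colorable_ex G).

Definition equitable_total_chromatic (G : sgraph) : nat :=
  ex_minn (equitably_total_colorable_ex G).

Definition sum_total_chromatic (G : sgraph) : nat :=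
  ex_minn (sum_total_colorable_ex G).

(* 'I_n represents the residues modulo n; the two disjuncts say that
   x - y is d, respectively - d, modulo n. *)
Definition power_cycle_adj (n k : nat) : rel 'I_n := fun x y =>
  (x != y) && [exists d : 'I_k.+1, (0 < d) &&
    ((x == y + d %[mod n]) || (y == x + d %[mod n]))].
Arguments power_cycle_adj : clear implicits.

Lemma power_cycle_adj_sym n k : symmetric (power_cycle_adj n k).
Proof.
move=> x y; rewrite /power_cycle_adj eq_sym; congr (_ && _).
by apply: eq_existsb => d; rewrite orbC.
Qed.

Lemma power_cycle_adj_irrefl n k : irreflexive (power_cycle_adj n k).
Proof. by move=> x; rewrite /power_cycle_adj eqxx. Qed.

Definition power_cycle (n k : nat) : sgraph :=
  SGraph (@power_cycle_adj_sym n k) (@power_cycle_adj_irrefl n k).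

(* Main.v *)
(** For an odd modulus m = 2k + 1 dividing n, color the vertex u with 2u and the
    edge uv with u + v modulo m.  The closed neighborhood of u represents every
    residue modulo m once, so every vertex sees every color exactly once; as the
    vertices are evenly distributed among the colors, so are the elements.
    For the last part, recolor the edges of the Hamiltonian cycle 0, 1, ..., n - 1
    alternately with two new colors, which is possible since n is even.  The
    vertex u loses the colors 2u - 1 and 2u + 1, so that its sum becomes a constant
    minus 4u modulo m, and adjacent vertices are not congruent modulo m. *)
Require Import Defs.
From mathcomp Require Import all_boot zify.

Set Implicit Arguments.
Unset Strict Implicit.
Unset Printing Implicit Defensive.

(** * Elements incident with a vertex, encoded as sets of vertices *)

Section Graph.
Variable G : sgraph.
Implicit Types (u v : G) (e : edge G) (s t : element G).

(** Treats vertices and edges alike: the elements meeting [u] become the sets [[set u; v]] with [v]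
    in the closed neighborhood, where [v = u] yields the vertex itself. *)
Definition support (t : element G) : {set G} :=
  match t with inl u => [set u] | inr e => val e end.

Definition closed_nbhd u : {set G} := [set v | (v == u) || adj u v].

Lemma edgeP e : exists u v, adj u v /\ val e = [set u; v].
Proof.
case: e => E /=; rewrite inE => /existsP[u /existsP[v /andP[uv /eqP->]]].
by exists u, v.
Qed.

Lemma adj_neq u v : adj u v -> u != v.
Proof. by apply: contraTneq => ->; rewrite adj_irrefl. Qed.

Lemma card_support t : #|support t| = (if t is inl _ then 1 else 2).
Proof.
case: t => [u|e] /=; first by rewrite cards1.
by have [u [v [/adj_neq uv ->]]] := edgeP e; rewrite cards2 uv.
Qed.

Lemma support_inj : injective support.
Proof.
move=> s t st; have := card_support s; rewrite st card_support.
case: s t st => [u|e] [v|f] //= st _; last by rewrite (val_inj st).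
by rewrite (set1_inj st).
Qed.

Lemma set2_inj u : injective (fun v => [set u; v]).
Proof.
move=> v w /setP vw; have := vw v; have := vw w.
rewrite !inE !eqxx !orbT => wv /esym vw'.
by case/orP: wv vw' => /eqP // ->; rewrite orbb => /eqP.
Qed.

Lemma support_star u :
  support @: [set t | u \in support t] = (fun v => [set u; v]) @: closed_nbhd u.
Proof.
apply/setP=> E; apply/imsetP/imsetP => [[t]|[v]]; rewrite inE.
  case: t => [x|e] /=.
    by rewrite inE => /eqP<- ->; exists u; rewrite ?inE ?eqxx // setUid.
  have [x [y [xy ->]]] := edgeP e.
  rewrite !inE => /orP[] /eqP-> ->; [exists y | exists x] => //.
  - by rewrite inE xy orbT.
  - by rewrite inE adj_sym xy orbT.
  - by rewrite setUC.
case: eqP => [-> _ ->|_ /= uv ->].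
  by exists (inl u); rewrite /= ?inE // setUid.
have eE : [set u; v] \in edges G.
  by rewrite inE; apply/existsP; exists u; apply/existsP; exists v; rewrite uv eqxx.
by exists (inr (exist (fun E => E \in edges G) _ eE)); rewrite //= !inE eqxx.
Qed.

Lemma sum_star u (F : {set G} -> nat) :
  \sum_(t | u \in support t) F (support t) = \sum_(v in closed_nbhd u) F [set u; v].
Proof.
have star_inj : {in closed_nbhd u &, injective (fun v => [set u; v])}.
  exact: in2W (@set2_inj u).
have supp_inj : {in [set t | u \in support t] &, injective support}.
  exact: in2W support_inj.
rewrite -(big_imset F star_inj) -support_star (big_imset F supp_inj) /=.
by apply: eq_bigl => t; rewrite inE.
Qed.

Lemma card_star u : #|[set t | u \in support t]| = #|closed_nbhd u|.
Proof. by rewrite cardsE -!sum1_card (sum_star u (fun=> 1)). Qed.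

Lemma card_closed_nbhd u : #|closed_nbhd u| = #|[set v | adj u v]|.+1.
Proof.
have -> : closed_nbhd u = u |: [set v | adj u v] by apply/setP=> v; rewrite !inE.
by rewrite cardsU1 inE adj_irrefl.
Qed.

Lemma star_conflict u s t :
  u \in support s -> u \in support t -> s != t -> conflict s t.
Proof.
case: s t => [x|e] [y|f] /=.
- by rewrite !inE => /eqP<- /eqP<-; rewrite eqxx.
- by rewrite inE => /eqP<-.
- by move=> ue; rewrite inE => /eqP<-.
move=> ue uf /negPf ef; apply/andP; split.
  by apply: contraFneq ef => ->.
by apply/set0Pn; exists u; rewrite inE ue.
Qed.

(** * Counting color classes when every vertex sees every color *)

Section TotalColoring.
Variables (q : nat) (c : coloring G q).

Lemma color_sumE u : color_sum c u = \sum_(t | u \in support t) (c t).+1.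
Proof.
rewrite big_sumType /= /color_sum; congr (_ + _).
by rewrite (big_pred1 u) // => v; rewrite /= inE eq_sym.
Qed.

Hypothesis c_total : total_coloring c.

Lemma star_color_inj u : {in [set t | u \in support t] &, injective c}.
Proof.
move=> s t; rewrite !inE => us ut cst; apply/eqP; apply: contraT => st.
have /forallP/(_ s)/forallP/(_ t) := c_total.
by rewrite (star_conflict us ut st) cst eqxx.
Qed.

Lemma card_closed_nbhd_le u : #|closed_nbhd u| <= q.
Proof.
rewrite -card_star -(card_in_imset (@star_color_inj u)).
by rewrite -[X in _ <= X]card_ord max_card.
Qed.

Hypothesis nbhd_card : forall u, #|closed_nbhd u| = q.

(** The elements meeting [u] conflict pairwise and there are exactly [q] of them, so their colors
    exhaust ['I_q]. *)
Lemma card_star_color u i : #|[set t in color_class c i | u \in support t]| = 1.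
Proof.
have /imsetP[t] : i \in c @: [set t | u \in support t].
  suff -> : c @: [set t | u \in support t] = setT by [].
  apply/eqP; rewrite eqEcard subsetT cardsT card_ord.
  by rewrite (card_in_imset (@star_color_inj u)) card_star nbhd_card leqnn.
rewrite inE => ut it; rewrite -(cards1 t); congr #|pred_of_set _|.
apply/setP=> s; rewrite !inE; apply/andP/eqP => [[/eqP cs us]|->].
  by apply: (@star_color_inj u); rewrite ?inE ?cs.
by rewrite it.
Qed.

(** Double counting of incidences between vertices and elements of color [i]: each vertex lies in
    one such element, an edge is counted twice and a vertex once. *)
Lemma card_color_class i :
  #|color_class c i| * 2 = #|G| + #|[set u | c (inl u) == i]|.
Proof.
have <- : \sum_(t in color_class c i) #|support t| = #|G|.
  under eq_bigr do rewrite -sum1_card.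
  rewrite (exchange_big_dep predT) //= -sum1_card.
  apply: eq_bigr => u _; rewrite -[RHS](card_star_color u i) -sum1_card.
  by apply: eq_bigl => t; rewrite !inE.
rewrite -!sum1_card big_distrl /= !big_sumType /=.
under [X in _ = (X + _) + _]eq_bigr do rewrite cards1.
under [X in _ = (_ + X) + _]eq_bigr => e _ do rewrite (card_support (inr e)).
rewrite addnAC; congr (_ + _); rewrite !mul1n.
rewrite [X in _ = _ + X](eq_bigl (fun u => inl u \in color_class c i)); last first.
  by move=> u; rewrite !inE.
by rewrite -big_split.
Qed.

(** The size of a class depends only on its number of vertices; the hypothesis, taken in both
    directions, makes these numbers equal. *)
Lemma equitable_of_vertices :
  (forall i j, #|[set u | c (inl u) == i]| <= #|[set u | c (inl u) == j]|) ->
  equitable c.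
Proof.
move=> le_ij; apply/forallP=> i; apply/forallP=> j.
have := card_color_class i; have := card_color_class j; have := le_ij i j; lia.
Qed.

End TotalColoring.

(** * Total colorings given by a symmetric function of two vertices *)

Section SymmetricColoring.
Variables (q : nat) (h : G -> G -> 'I_q).
Hypothesis h_sym : forall u v, h u v = h v u.

Lemma symmetric_coloring :
  exists c : coloring G q, forall t u v, support t = [set u; v] -> c t = h u v.
Proof.
(* The option type avoids a default color, as ['I_q] may be empty; [c0T] shows that [None] never
   occurs. *)
pose c0 t : option 'I_q :=
  omap (fun p => h p.1 p.2) [pick p : G * G | support t == [set p.1; p.2]].
have c0E t u v : support t = [set u; v] -> c0 t = Some (h u v).
  move=> tE; rewrite /c0; case: pickP => [[x y] /= /eqP|/(_ (u, v))]; last first.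
    by rewrite /= tE eqxx.
  rewrite tE => E; congr Some.
  have : u \in [set x; y] by rewrite -E !inE eqxx.
  by rewrite !inE => /orP[] /eqP uE; move: E; rewrite uE;
    [|rewrite h_sym [RHS]setUC] => /set2_inj ->.
have c0T t : c0 t.
  case: t => [u|e]; first by rewrite (c0E (inl u) u u) //= setUid.
  by have [u [v [_ eE]]] := edgeP e; rewrite (c0E (inr e) u v).
have get t : {i | c0 t = Some i} by have := c0T t; case: (c0 t) => // i; exists i.
exists [ffun t => sval (get t)] => t u v /c0E tE; rewrite ffunE.
by case: (get t) => i /=; rewrite tE => -[].
Qed.

Variable c : coloring G q.
Hypothesis cE : forall t u v, support t = [set u; v] -> c t = h u v.

Lemma vertex_color u : c (inl u) = h u u.
Proof. by apply: cE; rewrite /= setUid. Qed.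

(** Conflicts involving an edge take place around a common vertex [u], where injectivity of [h u]
    settles them; only adjacent vertices need a separate condition. *)
Lemma total_symmetric_coloring :
  (forall u v, adj u v -> h u u != h v v) ->
  (forall u, {in closed_nbhd u &, injective (h u)}) ->
  total_coloring c.
Proof.
move=> h_vertex h_inj.
have inc_vertex u e : u \in val e -> c (inl u) != c (inr e).
  have [x [y [xy eE]]] := edgeP e; rewrite eE vertex_color.
  rewrite !inE => /orP[] /eqP->.
    rewrite (cE (u := x) (v := y)) //; apply: contraNneq (adj_neq xy).
    by move/(h_inj x)->; rewrite // !inE ?eqxx // xy orbT.
  rewrite setUC in eE; rewrite (cE (u := y) (v := x)) //.
  apply: contraNneq (adj_neq xy).
  by move/(h_inj y)->; rewrite // !inE ?eqxx // adj_sym xy orbT.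
have other e u : u \in val e -> exists2 v, v \in closed_nbhd u & val e = [set u; v].
  have [x [y [xy eE]]] := edgeP e; rewrite eE !inE => /orP[] /eqP->.
    by exists y => //; rewrite inE xy orbT.
  by exists x; rewrite ?inE 1?adj_sym ?xy ?orbT // setUC.
apply/forallP=> s; apply/forallP=> t; apply/implyP.
case: s t => [u|e] [v|f] /=.
- by rewrite !vertex_color => /h_vertex.
- exact: inc_vertex.
- by rewrite eq_sym => /inc_vertex.
case/andP=> ef /set0Pn[u]; rewrite inE => /andP[/other[v uv eE] /other[w uw fE]].
apply: contraNneq ef; rewrite (cE (t := inr e) eE) (cE (t := inr f) fE).
move=> /(h_inj u _ _ uv uw) vw.
by apply/eqP/val_inj; rewrite eE fE vw.
Qed.

Lemma color_sum_symmetric u :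
  color_sum c u = \sum_(v in closed_nbhd u) (h u v).+1.
Proof.
(* Expresses the color through the support, which is what [sum_star] can reindex; the value 0 off
   the supports is never met. *)
pose F (E : {set G}) : nat :=
  if [pick t | support t == E] is Some t then (c t).+1 else 0.
have FE t : F (support t) = (c t).+1.
  by rewrite /F; case: pickP => [s /eqP/support_inj->|/(_ t)] //; rewrite eqxx.
rewrite color_sumE; under eq_bigr do rewrite -FE.
rewrite sum_star; apply: eq_bigr => v uv.
have : [set u; v] \in support @: [set t | u \in support t].
  by rewrite support_star; apply: imset_f uv.
by case/imsetP=> t _ tE; rewrite tE FE (cE (esym tE)).
Qed.

End SymmetricColoring.
End Graph.

(** * Closed neighborhoods of the power of cycle and residues modulo [m] *)

Section PowerCycle.
Variables n k : nat.
Let m := 2 * k + 1.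
Hypothesis hk : 0 < k.
Hypothesis m_dvd_n : m %| n.
Hypothesis hn : m < n.
Let G := power_cycle n k.
Implicit Types u v : 'I_n.

Lemma shift_subproof u s : (u + s) %% n < n.
Proof. by rewrite ltn_pmod // (leq_ltn_trans _ (ltn_ord u)). Qed.

Definition shift u s : 'I_n := Ordinal (shift_subproof u s).

Lemma shift_mod u s : shift u s = u + s %[mod m].
Proof. by rewrite /= modn_dvdm. Qed.

Lemma eqm_addl p q s : p + q = p + s %[mod m] -> q = s %[mod m].
Proof. by move/eqP; rewrite eqn_modDl => /eqP. Qed.

(** Since [2 * k.+1 = m + 1], the factor [k.+1] inverts 2 modulo [m]. *)
Lemma eqm_double p q : 2 * p = 2 * q %[mod m] -> p = q %[mod m].
Proof.
move=> /(congr1 (fun x => (k.+1 * x) %% m)); rewrite !modnMmr.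
have E x : k.+1 * (2 * x) = x * m + x by rewrite /m; nia.
by rewrite !E !modnMDl.
Qed.

(* [u + (a - k)] modulo [n], without truncation; [a = k] gives [u] itself. *)
Definition neighbor u (a : 'I_m) : 'I_n := shift u (a + (n - k)).

Lemma neighbor_mod_inj u a b : neighbor u a = neighbor u b %[mod m] -> a = b.
Proof.
rewrite !shift_mod => /eqm_addl; rewrite ![_ + (n - k)]addnC => /eqm_addl.
by rewrite !modn_small // => /val_inj.
Qed.

Lemma neighbor_inj u : injective (neighbor u).
Proof. by move=> a b ab; apply: (@neighbor_mod_inj u); rewrite ab. Qed.

Lemma closed_nbhdE u : closed_nbhd (G := G) u = neighbor u @: setT.
Proof.
have nb_shift (a : 'I_m) d : a = k + d :> nat -> neighbor u a = shift u d.
  move=> aE; apply: val_inj; rewrite /= aE.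
  by rewrite (_ : u + _ = u + d + n) ?modnDr //; lia.
have shift0 : shift u 0 = u by apply: val_inj; rewrite /= addn0 modn_small.
have km : k < m by rewrite /m; lia.
have nb_k : neighbor u (Ordinal km) = u by rewrite (nb_shift _ 0) ?addn0.
apply/setP=> v; rewrite inE; apply/orP/imsetP => [[/eqP->|]|[a _ ->]].
- by exists (Ordinal km).
- case/andP=> _ /existsP[d /andP[d0 /orP[]/eqP dE]].
    (* The index [k - d] encodes [v = u - d]; below, [k + d] encodes [v = u + d]. *)
    have am : k - d < m by rewrite /m; lia.
    exists (Ordinal am) => //; apply: val_inj; rewrite /= -(modn_small (ltn_ord v)).
    rewrite -modnDml dE modnDml (_ : v + d + _ = v + n) ?modnDr //.
    by have := ltn_ord d; lia.
  have am : k + d < m by have := ltn_ord d; rewrite /m; lia.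
  exists (Ordinal am) => //; rewrite (nb_shift _ d) //.
  by apply: val_inj; rewrite /= -dE modn_small.
have [ak|ak] := eqVneq a (Ordinal km); first by rewrite ak nb_k; left.
right; apply/andP; split.
  by apply: contraNneq ak => uE; rewrite -(inj_eq (@neighbor_inj u)) nb_k -uE.
have {}ak : a != k :> nat by [].
have am : a < 2 * k + 1 := ltn_ord a.
case: (ltnP a k) => ka.
  have dk : k - a < k.+1 by lia.
  apply/existsP; exists (Ordinal dk) => /=; rewrite subn_gt0 ka /=.
  rewrite modnDml (_ : u + _ + _ = u + n) ?modnDr ?eqxx //.
  by lia.
have dk : a - k < k.+1 by lia.
apply/existsP; exists (Ordinal dk) => /=; apply/andP; split; first by lia.
by rewrite modn_mod (_ : u + (a + _) = u + (a - k) + n) ?modnDr ?eqxx ?orbT //; lia.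
Qed.

Lemma card_closed_nbhd_power_cycle (u : G) : #|closed_nbhd u| = m.
Proof.
rewrite closed_nbhdE card_imset; last exact: neighbor_inj.
by rewrite cardsT card_ord.
Qed.

Lemma max_degree_power_cycle : max_degree G = 2 * k.
Proof.
have deg (u : G) : #|[set v | adj u v]| = 2 * k.
  apply: succn_inj; rewrite -card_closed_nbhd card_closed_nbhd_power_cycle.
  by rewrite /m addn1.
apply/eqP; rewrite eqn_leq; apply/andP; split.
  by apply/bigmax_leqP => u _; rewrite deg.
have n0 : 0 < n by apply: leq_ltn_trans hn.
by rewrite -(deg (Ordinal n0 : G)) leq_bigmax.
Qed.

Lemma closed_nbhd_mod_inj (u v w : G) :
  v \in closed_nbhd u -> w \in closed_nbhd u ->
  (v : 'I_n) = (w : 'I_n) %[mod m] -> v = w.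
Proof.
rewrite !closed_nbhdE => /imsetP[a _ ->] /imsetP[b _ ->].
by move/neighbor_mod_inj->.
Qed.

Lemma adj_mod_neq (u v : G) : adj u v -> (u : 'I_n) <> (v : 'I_n) %[mod m].
Proof.
move=> uv /(@closed_nbhd_mod_inj u u v) E; have /negP := adj_neq uv; apply.
by rewrite E ?inE ?eqxx ?uv ?orbT.
Qed.

(** * The coloring by sums modulo [m] and its equitability *)

Lemma sum_color_lt u v : (u + v) %% m < m.
Proof. by rewrite ltn_pmod // /m addn1. Qed.

Definition sum_color (u v : G) : 'I_m := Ordinal (sum_color_lt u v).

Lemma sum_color_inj (u : G) : {in closed_nbhd u &, injective (sum_color u)}.
Proof.
move=> v w uv uw /(congr1 val) /= /eqm_addl.
exact: closed_nbhd_mod_inj uv uw.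
Qed.

Lemma sum_color_vertex (u v : G) : adj u v -> sum_color u u != sum_color v v.
Proof.
move=> uv; apply/eqP => /(congr1 val) /=.
by rewrite !addnn -!mul2n => /eqm_double; apply: adj_mod_neq.
Qed.

Lemma sum_color_image (u : G) : sum_color u @: closed_nbhd u = setT.
Proof.
apply/eqP; rewrite eqEcard subsetT cardsT card_ord.
by rewrite (card_in_imset (@sum_color_inj u)) card_closed_nbhd_power_cycle leqnn.
Qed.

(** Vertex classes are compared by rotations: moving [u] by [s] adds [2 * s] to its color, so a
    suitable [s] injects the vertices of color [i] into those of color [j]. *)
Lemma power_cycle_equitably_total_colorable : equitably_total_colorable G m.
Proof.
have sym (u v : G) : sum_color u v = sum_color v u.
  by apply: val_inj; rewrite /= addnC.
have [c cE] := symmetric_coloring sym.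
have c_total := total_symmetric_coloring cE sum_color_vertex sum_color_inj.
apply/existsP; exists c; rewrite c_total /=.
apply: (equitable_of_vertices c_total card_closed_nbhd_power_cycle) => i j.
(* [2 * s = j - i] modulo [m], as [2 * k.+1 = 1]. *)
pose s := k.+1 * (j + (m - i)).
have shift_inj : injective (fun u => shift u s).
  move=> u v /(congr1 val) /= /eqP.
  by rewrite eqn_modDr !modn_small // => /eqP/val_inj.
rewrite -(card_imset _ shift_inj); apply/subset_leq_card/subsetP => w.
case/imsetP=> u; rewrite inE (vertex_color cE) => /eqP/(congr1 val) /= ui ->.
rewrite inE (vertex_color cE); apply/eqP/val_inj => /=.
rewrite -modnDm !modn_dvdm // modnDm.
rewrite (_ : u + s + (u + s) = u + u + 2 * s); last by lia.
rewrite -modnDml ui.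
rewrite (_ : i + 2 * s = (j + (m - i)) * m + (m + j)); last first.
  by have := ltn_ord i; rewrite /s /m; nia.
by rewrite modnMDl modnDl modn_small.
Qed.

(** A vertex and its incident edges already force [m] colors in any total coloring, and [m] suffice
    for an equitable one. *)
Lemma equitable_total_chromatic_power_cycle :
  equitable_total_chromatic G = total_chromatic G.
Proof.
have n0 : 0 < n by apply: leq_ltn_trans hn.
rewrite /equitable_total_chromatic /total_chromatic.
case: ex_minnP => p /existsP[c /andP[c_total _]] pmin.
have pm := pmin _ power_cycle_equitably_total_colorable.
case: ex_minnP => q /existsP[d d_total] qmin.
apply/eqP; rewrite eqn_leq; apply/andP; split.
  apply: leq_trans pm _; rewrite -(card_closed_nbhd_power_cycle (Ordinal n0)).
  exact: card_closed_nbhd_le d_total _.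
by apply: qmin; apply/existsP; exists c.
Qed.

(** * Recoloring the Hamiltonian cycle with two new colors *)

Hypothesis n_even : ~~ odd n.

(** Evenness of [n] matters at the wrap from [n - 1] to 0. *)
Lemma odd_ordS u : odd (ordS u) = ~~ odd u.
Proof. by rewrite /= odd_mod //; apply: negbTE. Qed.

Lemma ordS_mod u : ordS u = u + 1 %[mod m].
Proof. by rewrite /= modn_dvdm // addn1. Qed.

Lemma ord_pred_mod u : ord_pred u + 1 = u %[mod m].
Proof. by rewrite -ordS_mod ord_predK. Qed.

Lemma ordS_neq u : ordS u != u.
Proof.
apply/eqP=> E; have := ordS_mod u; rewrite E -{1}[val u]addn0 => /eqm_addl.
by rewrite mod0n modn_small // /m; lia.
Qed.

Lemma ordS_nbhd (u : G) : ordS u \in closed_nbhd u.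
Proof.
have dk : 1 < k.+1 by [].
rewrite inE; apply/orP; right; rewrite /= /power_cycle_adj eq_sym ordS_neq /=.
apply/existsP; exists (Ordinal dk) => /=.
by apply/orP; right; rewrite addn1 modn_mod.
Qed.

Lemma ord_pred_nbhd (u : G) : ord_pred u \in closed_nbhd u.
Proof.
have := ordS_nbhd (ord_pred u).
by rewrite ord_predK !inE adj_sym eq_sym.
Qed.

(** Equality would give 2 = 0 modulo [m], but [m] is at least 3. *)
Lemma ordS_neq_pred u : ordS u != ord_pred u.
Proof.
apply/eqP=> E; have := ordS_mod u; rewrite E => E'.
have := ord_pred_mod u; rewrite -modnDml E' modnDml -addnA -{2}[val u]addn0.
by move/eqm_addl; rewrite mod0n modn_small // /m; lia.
Qed.

(** The parity of the tail of the arc from a vertex to its successor selects [m] or [m.+1]; both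
    orientations are tested to keep the function symmetric. *)
Definition recolor (u v : G) : nat :=
  if odd u && (ordS u == v) || odd v && (ordS v == u) then m.+1
  else if (ordS u == v) || (ordS v == u) then m else (u + v) %% m.

Lemma recolor_sym u v : recolor u v = recolor v u.
Proof. by rewrite /recolor orbC [(ordS u == v) || _]orbC addnC. Qed.

Lemma recolorE u v : recolor u v =
  if v == ordS u then m + odd u
  else if v == ord_pred u then m + ~~ odd u else (u + v) %% m.
Proof.
have predE : (ordS v == u) = (v == ord_pred u).
  by rewrite -(inj_eq (@ordS_inj _) v) ord_predK.
rewrite /recolor predE [ordS u == v]eq_sym.
have [->|vS] := eqVneq v (ordS u).
  rewrite (negPf (ordS_neq_pred u)) andbF andbT orbF.
  by case: (odd u); rewrite ?addn1 ?addn0.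
have [->|vP] := eqVneq v (ord_pred u); last by rewrite !andbF.
have := odd_ordS (ord_pred u); rewrite ord_predK => ->.
by rewrite andbF andbT negbK orbT; case: (odd (ord_pred u)); rewrite ?addn1 ?addn0.
Qed.

(** The two cycle edges at [u] get distinct colors that are at least [m]; all other colors are old
    ones, below [m] and already distinct. *)
Lemma recolor_inj (u : G) : {in closed_nbhd u &, injective (recolor u)}.
Proof.
have nodd : odd u + ~~ odd u = 1 by case: (odd u).
move=> v w uv uw; rewrite !recolorE.
have := sum_color_lt u v; have := sum_color_lt u w.
case: eqVneq => [->|_]; [|case: eqVneq => [->|_]];
  (case: eqVneq => [->|_]; [|case: eqVneq => [->|_]]) => //; try lia.
by move=> _ _ /eqm_addl; apply: closed_nbhd_mod_inj uv uw.
Qed.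

(** New sum plus lost colors equals old sum plus gained colors, stated without subtraction. The old
    sum is the same at every vertex, since each color is seen once. *)
Lemma sum_recolor (u : G) :
  \sum_(v in closed_nbhd u) (recolor u v).+1
    + ((u + ordS u) %% m).+1 + ((u + ord_pred u) %% m).+1
  = \sum_(i < m) i.+1 + m.+1 + m.+2.
Proof.
have <- : \sum_(v in closed_nbhd u) (sum_color u v).+1 = \sum_(i < m) i.+1.
  rewrite -(big_imset (fun i : 'I_m => i.+1) (@sum_color_inj u)) sum_color_image.
  by apply: eq_bigl => i; rewrite inE.
have pred_nbhd : (ord_pred u \in closed_nbhd u) && (ord_pred u != ordS u).
  by rewrite ord_pred_nbhd eq_sym ordS_neq_pred.
rewrite (bigD1 (ordS u) (ordS_nbhd u)) (bigD1 (ord_pred u) pred_nbhd) /=.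
rewrite [in RHS](bigD1 (ordS u) (ordS_nbhd u)).
rewrite [in RHS](bigD1 (ord_pred u) pred_nbhd) /=.
rewrite !recolorE !eqxx eq_sym (negPf (ordS_neq_pred u)).
rewrite (eq_bigr (fun v => (sum_color u v).+1)); last first.
  by move=> v /andP[/andP[_ /negPf vS] /negPf vP]; rewrite recolorE vS vP.
have nodd : odd u + ~~ odd u = 1 by case: (odd u).
rewrite /=; set x := _ %% m; set y := _ %% m; set z := bigop _ _ _.
by clearbody x y z; lia.
Qed.

Lemma power_cycle_sum_total_colorable : sum_total_colorable G (2 * k + 3).
Proof.
have recolor_lt u v : recolor u v < 2 * k + 3.
  rewrite recolorE; have := sum_color_lt u v; rewrite /m.
  by do 2?case: ifP => _; case: (odd u); lia.
pose h (u v : G) := Ordinal (recolor_lt u v).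
have sym (u v : G) : h u v = h v u by apply: val_inj; apply: recolor_sym.
have [c cE] := symmetric_coloring sym.
(* No vertex is its own successor or predecessor, so vertices keep their colors. *)
have vertexE (u : G) : recolor u u = (u + u) %% m.
  rewrite recolorE eq_sym (negPf (ordS_neq u)).
  by have := ordS_neq (ord_pred u); rewrite ord_predK => /negPf->.
apply/existsP; exists c; apply/andP; split.
  apply: (total_symmetric_coloring cE) => [u v uv|u v w uv uw [/recolor_inj->]//].
  rewrite -val_eqE /= !vertexE.
  by have := sum_color_vertex uv; rewrite -val_eqE.
apply/forallP=> u; apply/forallP=> v; apply/implyP=> uv; apply/eqP.
rewrite !(color_sum_symmetric cE) /= => E.
(* Equal sums at [u] and [v] cancel, leaving equal totals of lost colors, which are compared modulo
   [m]. *)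
have := sum_recolor u; rewrite E -(sum_recolor v) -!addnA => /addnI.
rewrite !addSn !addnS => -[] /(congr1 (modn^~ m)).
rewrite !modnDm.
have sumE (w : 'I_n) : w + ordS w + (w + ord_pred w) = 2 * (2 * w) %[mod m].
  (* The added 1 turns [ord_pred w] into [w] modulo [m] and avoids subtraction. *)
  apply: (@eqm_addl 1).
  rewrite (_ : 1 + _ = (ordS w + (ord_pred w + 1)) + 2 * w); last by lia.
  rewrite -modnDml -(modnDm (ordS w)) ordS_mod ord_pred_mod modnDm modnDml.
  by congr (_ %% _); lia.
(* From [4u = 4v] modulo the odd [m], halving twice gives [u = v] modulo [m], impossible for
   adjacent vertices. *)
by rewrite !sumE => /eqm_double/eqm_double; apply: adj_mod_neq.
Qed.

End PowerCycle.

Theorem theorem2p2 (n k : nat) (hk : 1 <= k < n./2) (hn : ~~ odd n)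
    (hdiv : 2 * k + 1 %| n) :
  equitable_total_chromatic (power_cycle n k) = total_chromatic (power_cycle n k)
  /\ (sum_total_chromatic (power_cycle n k) <= 2 * k + 3
      /\ 2 * k + 3 = max_degree (power_cycle n k) + 3).
Proof.
have [k0 kn] := andP hk.
have mn : 2 * k + 1 < n by lia.
split; first exact: equitable_total_chromatic_power_cycle.
split; last by rewrite max_degree_power_cycle.
rewrite /sum_total_chromatic; case: ex_minnP => q _; apply.
exact: power_cycle_sum_total_colorable.
Qed.
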